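(* Let $V=\{1,\dots,n\}$, let $\widetilde f=(\widetilde f_1,\dots,\widetilde f_n)$ be a vector of fuzzy sets over a universe $U\subset\mathbb{R}^+$, let $D:F(\mathbb{R}^+)\to\mathbb{R}^+$ be a defuzzification operator, and let $p=1$. Then the set function $\mu_{f,p}:2^V\to\mathbb{R}$ built from $\widetilde f$, $D$ and $p$ is a fuzzy Sugeno $\lambda$-measure (that is, a fuzzy measure satisfying the Sugeno $\lambda$-rule), and it is $1$-additive.
   Context: $\mathbb{R}^+$ denotes the positive real numbers. A fuzzy set on $\mathbb{R}^+$ is given by a membership function $\mathbb{R}^+\to[0,1]$; $F(\mathbb{R}^+)$ is the collection of all fuzzy sets on $\mathbb{R}^+$. A fuzzy set $\widetilde f_i$ over $U\subset\mathbb{R}^+$, with membership function $\eta_{f_i}:U\to[0,1]$, is regarded as a fuzzy set on $\mathbb{R}^+$ (membership $0$ outside $U$). A defuzzification operator is any map $D:F(\mathbb{R}^+)\to\mathbb{R}^+$. Definition of $\mu_{f,p}$ for $p\in(0,1]$. On singletons, $$\mu_{f,p}(i)=\mu_{f,p}(\{i\})=\frac{p\,D(\widetilde f_i)}{\sum_{k=1}^n D(\widetilde f_k)},\qquad i\in V.$$ Let $\lambda\in(-1,\infty)$ be a solution of $\lambda+1=\prod_{i=1}^n(1+\lambda\mu_{f,p}(i))$, where, as usual for Sugeno measures, $\lambda$ is taken to be a nonzero solution in $(-1,\infty)$ if one exists, and $\lambda=0$ otherwise. Then $\mu_{f,p}:2^V\to\mathbb{R}$ is the set function with these singleton values that satisfies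 $$\mu_{f,p}(M\cup N)=\mu_{f,p}(M)+\mu_{f,p}(N)+\lambda\,\mu_{f,p}(M)\mu_{f,p}(N)\qquad\text{for all } M,N\subseteq V \text{ with } M\cap N=\emptyset .$$ A fuzzy measure on $V$ is a set function $\mu:2^V\to[0,1]$ with $\mu(\emptyset)=0$, $\mu(V)=1$, and $\mu(M)\le\mu(N)$ whenever $M\subseteq N\subseteq V$. A (fuzzy) Sugeno $\lambda$-measure is a fuzzy measure $\mu$ for which there is $\lambda\in(-1,\infty)$ with $\mu(M\cup N)=\mu(M)+\mu(N)+\lambda\mu(M)\mu(N)$ for all disjoint $M,N\subseteq V$. A fuzzy measure $\mu$ on $V$ is $1$-additive if there are real numbers $a_1,\dots,a_n$ with $\mu(S)=\sum_{i\in S}a_i$ for all $S\subseteq V$. *)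

(* Defs.v *)
From mathcomp Require Import all_boot all_order all_algebra.
From mathcomp Require Import boolp classical_sets functions.
From mathcomp Require Import reals interval_inference ring.

Set Implicit Arguments.
Unset Strict Implicit.
Unset Printing Implicit Defensive.

Import Order.TTheory GRing.Theory Num.Theory.
Local Open Scope ring_scope.

Definition fuzzy_set (R : realType) (T : Type) := T -> {i01 R}.

(* A fuzzy set over [U] as a fuzzy set on all of [T]: membership is 0 outside
   [U]. *)
Definition fuzzy_ext (R : realType) (T : Type) (U : set T)
  (f : fuzzy_set R U) : fuzzy_set R T := 'valL_ (0%:i01 : {i01 R}) f.

Definition defuzzification (R : realType) :=
  fuzzy_set R {posnum R} -> {posnum R}.

Section SetFunctions.
Variables (R : realType) (n : nat).
Implicit Types (d : 'I_n -> R) (mu : {set 'I_n} -> R) (lambda : R).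

Definition sugeno_rule lambda mu :=
  forall M N : {set 'I_n}, [disjoint M & N] ->
    mu (M :|: N) = mu M + mu N + lambda * mu M * mu N.

Definition fuzzy_measure mu :=
  [/\ forall S : {set 'I_n}, 0 <= mu S <= 1,
      mu finset.set0 = 0,
      mu [set: 'I_n]%SET = 1
    & forall M N : {set 'I_n}, M \subset N -> mu M <= mu N].

Definition sugeno_measure mu :=
  fuzzy_measure mu /\ exists lambda, -1 < lambda /\ sugeno_rule lambda mu.

Definition one_additive mu :=
  exists a : 'I_n -> R, forall S : {set 'I_n}, mu S = \sum_(i in S) a i.

Definition sugeno_equation d lambda :=
  -1 < lambda /\ lambda + 1 = \prod_(i < n) (1 + lambda * d i).

(* 0 always solves the equation; it is admitted only when it is the sole
   solution in ]-1, +oo[. *)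
Definition sugeno_parameter d lambda :=
  sugeno_equation d lambda /\
  ((exists l, l != 0 /\ sugeno_equation d l) -> lambda != 0).

End SetFunctions.

Section MuFp.
Variables (R : realType) (n : nat) (U : set {posnum R}).
Variables (f : 'I_n -> fuzzy_set R U) (D : defuzzification R) (p : R).

Definition mu_fp_singleton (i : 'I_n) : R :=
  p * (D (fuzzy_ext (f i)))%:num / \sum_(k < n) (D (fuzzy_ext (f k)))%:num.

(* [is_mu_fp lambda mu]: [mu] is the set function mu_{f,p} obtained from the
   choice [lambda] of the parameter (see [mu_fp_exists_unique]). *)
Definition is_mu_fp (lambda : R) (mu : {set 'I_n} -> R) :=
  [/\ sugeno_parameter mu_fp_singleton lambda,
      forall i : 'I_n, mu [set i]%SET = mu_fp_singleton i
    & sugeno_rule lambda mu].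

End MuFp.

Lemma sugeno_parameter_exists (R : realType) (n : nat) (d : 'I_n -> R) :
  exists lambda, sugeno_parameter d lambda.
Proof.
have [[l [l0 hl]]|h] := pselect (exists l, l != 0 /\ sugeno_equation d l).
  by exists l.
exists 0; split=> //; split; first by rewrite ltrN10.
by rewrite add0r big1 // => i _; rewrite mul0r addr0.
Qed.

Lemma sugeno_rule_exists (R : realType) (n : nat) (d : 'I_n -> R)
    (lambda : R) :
  exists mu : {set 'I_n} -> R,
    (forall i, mu [set i]%SET = d i) /\ sugeno_rule lambda mu.
Proof.
have [->|l0] := eqVneq lambda 0.
  exists (fun S : {set 'I_n} => \sum_(i in S) d i); split=> [i|M N dMN].
    by rewrite big_set1.
  rewrite !mul0r addr0 -bigU //; apply: eq_bigl => i; exact: finset.in_setU.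
exists (fun S : {set 'I_n} => (\prod_(i in S) (1 + lambda * d i) - 1) / lambda).
split=> [i|M N dMN].
  by rewrite big_set1 addrAC subrr add0r mulrC mulKf.
have -> : \prod_(i in M :|: N) (1 + lambda * d i) =
  \prod_(i in M) (1 + lambda * d i) * \prod_(i in N) (1 + lambda * d i).
  by rewrite -bigU //; apply: eq_bigl => i; exact: finset.in_setU.
set a := \prod_(i in M) _; set b := \prod_(i in N) _.
by field.
Qed.

Lemma sugeno_rule_unique (R : realType) (n : nat) (d : 'I_n -> R)
    (lambda : R) (mu nu : {set 'I_n} -> R) :
  (0 < n)%N -> (forall i, 1 + lambda * d i != 0) ->
  (forall i, mu [set i]%SET = d i) -> sugeno_rule lambda mu ->
  (forall i, nu [set i]%SET = d i) -> sugeno_rule lambda nu ->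
  mu = nu.
Proof.
move=> n0 hd; have mu0 m : (forall i, m [set i]%SET = d i) ->
    sugeno_rule lambda m -> m finset.set0 = 0.
  move=> m1 mr; pose i := Ordinal n0.
  have := mr [set i]%SET finset.set0.
  rewrite finset.setU0 finset.disjoints_subset finset.setC0 finset.subsetT.
  move=> /(_ isT)/eqP; rewrite m1 -addrA addrC -subr_eq subrr eq_sym.
  by rewrite -{1}[m _]mul1r -mulrDl mulf_eq0 (negPf (hd i)) => /eqP.
move=> m1 mr v1 vr; apply/funext => S.
have [k] := ubnP #|S|; elim: k S => // k IH S hS.
have [->|[i iS]] := finset.set_0Vmem S; first by rewrite !mu0.
rewrite -(finset.setD1K iS).
have dis : [disjoint [set i]%SET & (S :\ i)%SET].
  by rewrite disjoints1 finset.setD11.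
rewrite mr // vr // m1 v1 IH //.
by move: hS; rewrite (cardsD1 i S) iS.
Qed.

Lemma mu_fp_exists_unique (R : realType) (n : nat) (U : set {posnum R})
    (f : 'I_n -> fuzzy_set R U) (D : defuzzification R) (p lambda : R) :
  (0 < n)%N -> 0 < p <= 1 ->
  sugeno_parameter (mu_fp_singleton f D p) lambda ->
  exists! mu, is_mu_fp f D p lambda mu.
Proof.
move=> n0 /andP[p0 p1] hl; set d := mu_fp_singleton f D p.
pose D' i : R := (D (fuzzy_ext (f i)))%:num.
have D'0 i : 0 < D' i by rewrite /D'.
have hs i : D' i <= \sum_k D' k.
  by rewrite (bigD1 i) //= lerDl; apply: sumr_ge0 => j _; exact: ltW.
have s0 : 0 < \sum_k D' k by apply: lt_le_trans (hs (Ordinal n0)).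
have d0 i : 0 < d i by rewrite divr_gt0 // mulr_gt0 // D'0.
have d1 i : d i <= 1.
  rewrite ler_pdivrMr // mul1r; apply: le_trans (hs i).
  by rewrite ger_pMl.
have hd i : 1 + lambda * d i != 0.
  case: hl => [[l1 _] _]; rewrite gt_eqF // addrC -ltrBlDr sub0r.
  apply: (@le_lt_trans _ _ (- d i)); first by rewrite lerN2.
  by rewrite -mulN1r ltr_pM2r.
have [mu [m1 mr]] := sugeno_rule_exists d lambda.
exists mu; split=> [|nu [_ v1 vr]]; first by split.
exact: (sugeno_rule_unique n0 hd).
Qed.

(* Main.v *)
(** The weights d_i sum to 1. By the Bernoulli-type inequality applied to all
    factors but the i-th,
      1 + l = \prod_k (1 + l d_k) >= (1 + l d_i) (1 + l (1 - d_i))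
            = 1 + l + l^2 d_i (1 - d_i),
    so either l = 0 or some weight carries the whole mass (which happens only
    for n = 1). Either way the quadratic term of the Sugeno rule vanishes and mu
    is the additive measure with weights d_i. *)

Require Import Defs.
From mathcomp Require Import all_boot all_order all_algebra.
From mathcomp Require Import boolp classical_sets functions.
From mathcomp Require Import reals interval_inference.
From mathcomp Require Import ring lra.
Import Order.TTheory GRing.Theory Num.Theory.
Local Open Scope ring_scope.

Lemma add1_mul_gt0 (R : realDomainType) (l x : R) :
  -1 < l -> 0 <= x <= 1 -> 0 < 1 + l * x.
Proof. by move=> l1 /andP[x0 x1]; have [l0|l0] := leP 0 l; nra. Qed.

(** Weierstrass product inequality, by induction on the factors: the cross term [l ^+ 2 * (d i * s)]
    is nonnegative whatever the sign of [l], and each new factor is positive. *)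
Lemma prod_add1_ge_add1_sum (R : realDomainType) (I : finType) (P : pred I)
    (d : I -> R) (l : R) :
  -1 < l -> (forall i, 0 <= d i <= 1) ->
  1 + l * (\sum_(i | P i) d i) <= \prod_(i | P i) (1 + l * d i).
Proof.
move=> l1 d01.
(* The sign of the partial sum is carried through the induction to control the cross term. *)
suff [] : 0 <= \sum_(i | P i) d i /\
    1 + l * (\sum_(i | P i) d i) <= \prod_(i | P i) (1 + l * d i) by [].
elim/big_rec2: _ => [|i s p _ [s0 IH]]; first by rewrite mulr0 addr0.
have /andP[di0 _] := d01 i; split; first exact: addr_ge0.
apply: (@le_trans _ _ ((1 + l * d i) * (1 + l * s))).
  have -> : (1 + l * d i) * (1 + l * s) =
    1 + l * (d i + s) + l ^+ 2 * (d i * s) by ring.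
  by rewrite lerDl mulr_ge0 ?sqr_ge0 ?mulr_ge0.
by rewrite ler_pM2l // add1_mul_gt0.
Qed.

Lemma le1_of_sum1 (R : realDomainType) (I : finType) (d : I -> R) :
  (forall i, 0 <= d i) -> \sum_i d i = 1 -> forall i, 0 <= d i <= 1.
Proof.
move=> d0 d1 i; rewrite d0 -d1 (bigD1 i) //= lerDl.
exact: sumr_ge0.
Qed.

Lemma sugeno_equation_sum1 (R : realType) (n : nat) (d : 'I_n -> R) (l : R) :
  (forall i, 0 < d i) -> \sum_i d i = 1 -> sugeno_equation d l ->
  forall i, l != 0 -> d i = 1.
Proof.
move=> d0 d1 [l1 le] i l0.
have d01 := le1_of_sum1 _ _ d (fun i => ltW (d0 i)) d1.
have := prod_add1_ge_add1_sum _ _ (fun j => j != i) d l l1 d01.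
rewrite -(ler_pM2l (add1_mul_gt0 _ _ _ l1 (d01 i))).
have -> : \sum_(j | j != i) d j = 1 - d i.
  by rewrite -d1 [in RHS](bigD1 i) //= [in RHS]addrC addrK.
move: le; rewrite (bigD1 i) //= => <-.
have -> : (1 + l * d i) * (1 + l * (1 - d i)) =
  l + 1 + l ^+ 2 * d i * (1 - d i) by ring.
have ld0 : 0 < l ^+ 2 * d i by rewrite mulr_gt0 // exprn_even_gt0.
(* Cancelling [l + 1] leaves [l ^+ 2 * d i * (1 - d i) <= 0], hence [1 <= d i]. *)
rewrite gerDl pmulr_rle0 // subr_le0 => di1.
by apply/eqP; rewrite eq_le di1 andbT; case/andP: (d01 i).
Qed.

(** The rule for [M] and the empty set gives [(1 + l * mu M) * mu set0 = 0]. The nonzero factor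
    excludes the degenerate constant solution [- 1 / l]. *)
Lemma sugeno_rule_set0 (R : realType) (n : nat) (mu : {set 'I_n} -> R) (l : R)
    (M : {set 'I_n}) :
  sugeno_rule l mu -> 1 + l * mu M != 0 -> mu finset.set0 = 0.
Proof.
move=> mur M0; have := mur M finset.set0.
rewrite finset.setU0 finset.disjoints_subset finset.setC0 finset.subsetT.
move=> /(_ isT) E; have : (1 + l * mu M) * mu finset.set0 = 0.
  by rewrite mulrDl mul1r; apply: (addrI (mu M)); rewrite addr0 addrA -E.
by move/eqP; rewrite mulf_eq0 (negPf M0) => /eqP.
Qed.

Lemma sugeno_sum1_additive (R : realType) (n : nat) (d : 'I_n -> R) (l : R)
    (mu : {set 'I_n} -> R) :
  (0 < n)%N -> (forall i, 0 < d i) -> \sum_i d i = 1 -> sugeno_equation d l ->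
  (forall i, mu [set i]%SET = d i) -> sugeno_rule l mu ->
  forall S : {set 'I_n}, mu S = \sum_(i in S) d i.
Proof.
move=> n0 d0 d1 le mu1 mur S.
have d01 := le1_of_sum1 _ _ d (fun i => ltW (d0 i)) d1.
have [k] := ubnP #|S|; elim: k S => // k IH S hS.
have [->|[i iS]] := finset.set_0Vmem S.
  rewrite finset.big_set0.
  (* Any singleton serves as [M]; [0 < n] provides one. *)
  apply: (sugeno_rule_set0 _ _ mu l [set Ordinal n0]%SET) => //.
  by rewrite mu1 gt_eqF // add1_mul_gt0 // le.1.
have dis : [disjoint [set i]%SET & (S :\ i)%SET].
  by rewrite disjoints1 finset.setD11.
rewrite (finset.big_setD1 i iS) -{1}(finset.setD1K iS) mur // mu1 IH; last first.
  by move: hS; rewrite (cardsD1 i S) iS.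
have [->|l0] := eqVneq l 0; first by rewrite !mul0r addr0.
(* Since [l] is nonzero, [d i = 1] takes the whole mass, so the other weights sum to 0 and the
   quadratic term drops out. *)
have rest0 : \sum_(j | j != i) d j = 0.
  apply: (addrI (d i)); move: (d1); rewrite (bigD1 i) //= => ->.
  by rewrite addr0 (sugeno_equation_sum1 _ _ d l d0 d1 le).
have -> : \sum_(j in (S :\ i)%SET) d j = 0.
  apply: big1 => j; rewrite !inE => /andP[ji _].
  by move/psumr_eq0P: rest0 => ->// m _; exact: ltW.
by rewrite mulr0 addr0.
Qed.

Lemma additive_fuzzy_measure (R : realType) (n : nat) (d : 'I_n -> R)
    (mu : {set 'I_n} -> R) :
  (forall i, 0 <= d i) -> \sum_i d i = 1 ->
  (forall S : {set 'I_n}, mu S = \sum_(i in S) d i) -> fuzzy_measure mu.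
Proof.
move=> d0 d1 muE.
have muT : mu [set: 'I_n]%SET = 1.
  by rewrite muE -d1; apply: eq_bigl => i; rewrite inE.
have mono (M N : {set 'I_n}) : M \subset N -> mu M <= mu N.
  move=> MN; rewrite !muE (finset.big_setID M (A := N)) /=.
  by rewrite (finset.setIidPr MN) lerDl sumr_ge0.
split=> //; last by rewrite muE finset.big_set0.
(* The bound by 1 is monotonicity against the full set. *)
move=> S; rewrite -muT mono ?finset.subsetT // andbT muE.
exact: sumr_ge0.
Qed.

Theorem proposition1 (R : realType) (n : nat) (n_gt0 : (0 < n)%N)
  (U : set {posnum R}) (f : 'I_n -> fuzzy_set R U) (D : defuzzification R)
  (lambda : R) (mu : {set 'I_n} -> R) :
  is_mu_fp f D 1 lambda mu ->
  sugeno_measure mu /\ one_additive mu.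
Proof.
move=> [[le _] mu1 mur]; set d := mu_fp_singleton f D 1 in le mu1.
pose s : R := \sum_k (D (fuzzy_ext (f k)))%:num.
have s0 : 0 < s.
  by rewrite /s (bigD1 (Ordinal n_gt0)) //= ltr_pwDl // sumr_ge0.
have d0 i : 0 < d i by rewrite divr_gt0 // mul1r.
(* Here [p = 1] enters: for general [p] the weights sum to [p]. *)
have d1 : \sum_i d i = 1.
  rewrite -mulr_suml; under eq_bigr do rewrite mul1r.
  by rewrite divff // gt_eqF.
have muE := sugeno_sum1_additive _ _ d lambda mu n_gt0 d0 d1 le mu1 mur.
split; last by exists d.
split; last by exists lambda; split=> //; case: le.
exact: (additive_fuzzy_measure _ _ d mu (fun i => ltW (d0 i)) d1 muE).
Qed.
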